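(* Let $M=(E,\mathcal{B})$ be a matroid on the ground set $E=[n]=\{1,\dots,n\}$. Then the matroid base polytope $P_M=\operatorname{conv}\{\chi_B : B\in\mathcal{B}\}\subset\mathbb{R}^n$ has a regular unimodular triangulation.
   Context: A matroid is a pair $M=(E,\mathcal{B})$ with $E$ a finite set and $\mathcal{B}$ a nonempty collection of subsets of $E$ (the bases) such that for all $B_1,B_2\in\mathcal{B}$ and $x\in B_1\setminus B_2$ there is $y\in B_2\setminus B_1$ with $(B_1\setminus\{x\})\cup\{y\}\in\mathcal{B}$. For $S\subseteq[n]$, $\chi_S\in\mathbb{R}^n$ is the indicator vector: $\chi_S(i)=1$ if $i\in S$ and $0$ otherwise. A subdivision of a polytope $P$ is a finite collection $\mathcal{S}=\{P_1,\dots,P_k\}$ of polytopes such that (1) $\bigcup_i P_i=P$; (2) every face of each $P_i$ belongs to $\mathcal{S}$; (3) for all $i,j$, $P_i\cap P_j$ is a face of both $P_i$ and $P_j$. A triangulation is a subdivision all of whose members are simplices. Given a finite subset $S\subset P$ containing the vertices of $P$ and a function $f:S\to\mathbb{R}$, the subdivision of $P$ induced by $f$ is the one formed by projecting to $P$ (forgetting the last coordinate) the lower faces of $\operatorname{conv}\{(x,f(x)):x\in S\}\subset\mathbb{R}^{n+1}$, where a lower face is a face on which some linear functional with positive last coefficient is minimized. A subdivision is regular if it is induced by some such function $f$. For a set $T\subseteq\mathbb{R}^n$, $\operatorname{lin}(T)$ denotes the linear subspace parallel to, and of the same dimension as, the affine span of $T$. A simplex $T$ with vertices in $\mathbb{Z}^n$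 is unimodular if a maximal linearly independent set of its edge vectors (differences of two vertices) forms a lattice basis of $\operatorname{lin}(T)\cap\mathbb{Z}^n$ (equivalently, it has normalized volume 1). A triangulation is unimodular if all its simplices are unimodular. *)

(* Defs.v *)
From mathcomp Require Import all_boot all_order all_algebra.
From mathcomp Require Import boolp classical_sets cardinality reals.

Set Implicit Arguments.
Unset Strict Implicit.
Unset Printing Implicit Defensive.

Import Order.TTheory GRing.Theory Num.Theory.

Local Open Scope classical_set_scope.
Local Open Scope ring_scope.

Record matroid (E : finType) := Matroid {
  bases : {set {set E}};
  bases_nonempty : bases != finset.set0;
  bases_exchange : forall B1 B2 x,
    B1 \in bases -> B2 \in bases -> x \in B1 :\: B2 ->
    exists2 y, y \in B2 :\: B1 & y |: (B1 :\ x) \in bases }.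

Section Polytopes.
Variables (R : realType) (n : nat).
Local Notation V := 'rV[R]_n.
Implicit Types (A P Q F T : set V) (c x : V).

Definition dot c x : R := \sum_i c 0 i * x 0 i.

Definition conv A : set V :=
  [set x | exists k (p : 'I_k -> V) (w : 'I_k -> R),
    [/\ forall i, A (p i), forall i, 0 <= w i, \sum_i w i = 1
      & x = \sum_i w i *: p i]].

Definition aff A : set V :=
  [set x | exists k (p : 'I_k -> V) (w : 'I_k -> R),
    [/\ forall i, A (p i), \sum_i w i = 1 & x = \sum_i w i *: p i]].

(* The direction of [aff A]; the union with {0} only matters for A empty. *)
Definition lin A : set V :=
  [set 0] `|` [set x | exists y z, [/\ aff A y, aff A z & x = y - z]].

Definition is_polytope P := exists s : seq V, P = conv [set` s].

Definition face_cut P c (d : R) : set V := [set x | P x /\ dot c x = d].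

(* Faces are cut out by valid inequalities d <= dot c x.  As usual, P itself
   (c = 0, d = 0) and the empty set (c = 0, d < 0) are faces of P. *)
Definition is_face P F :=
  exists c d, (forall x, P x -> d <= dot c x) /\ F = face_cut P c d.

Definition is_vertex P x := is_face P [set x].

Definition aff_independent (s : seq V) :=
  forall w : 'I_(size s) -> R,
    \sum_i w i = 0 -> \sum_(i < size s) w i *: s`_i = 0 -> forall i, w i = 0.

(* The empty set is a simplex, of dimension -1. *)
Definition is_simplex T :=
  exists2 s : seq V, aff_independent s & T = conv [set` s].

Definition integral_point x := forall i, x 0 i \is a Num.int.

Definition is_edge_vector T x :=
  exists y z, [/\ is_vertex T y, is_vertex T z & x = y - z].

Definition is_max_free_edges T (b : seq V) :=
  [/\ forall x, x \in b -> is_edge_vector T x,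
      free b
    & forall x, is_edge_vector T x -> ~~ free (x :: b)].

Definition is_lattice_basis (L : set V) (b : seq V) :=
  free b /\
  L = [set x | exists z : 'I_(size b) -> int, x = \sum_(i < size b) b`_i *~ z i].

Definition is_unimodular_simplex T :=
  [/\ is_simplex T,
      forall x, is_vertex T x -> integral_point x
    & exists2 b, is_max_free_edges T b
               & is_lattice_basis (lin T `&` integral_point) b].

Definition is_subdivision P (S : set (set V)) :=
  [/\ finite_set S /\ (forall Q, S Q -> is_polytope Q),
      \bigcup_(Q in S) Q = P,
      forall Q F, S Q -> is_face Q F -> S F
    & forall Q Q', S Q -> S Q' ->
        is_face Q (Q `&` Q') /\ is_face Q' (Q `&` Q')].

Definition is_triangulation P (S : set (set V)) :=
  is_subdivision P S /\ forall Q, S Q -> is_simplex Q.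

Definition is_unimodular (S : set (set V)) :=
  forall T, S T -> is_unimodular_simplex T.

End Polytopes.

Section Regular.
Variables (R : realType) (n : nat).
Local Notation V := 'rV[R]_n.

Definition lift_point (f : V -> R) (x : V) : 'rV[R]_(n + 1) :=
  row_mx x (f x)%:M.

(* A face minimizing a functional whose last coefficient is positive; like
   any face it may be empty, when d is smaller than the minimum. *)
Definition is_lower_face (Q F : set 'rV[R]_(n + 1)) :=
  exists (c : 'rV[R]_(n + 1)) (d : R), [/\ 0 < c 0 (rshift n ord0),
    forall x, Q x -> d <= dot c x & F = face_cut Q c d].

(* Only the values of f on A matter. *)
Definition induced_subdivision (A : set V) (f : V -> R) : set (set V) :=
  [set Q | exists2 F, is_lower_face (conv (lift_point f @` A)) F
                    & Q = [set lsubmx y | y in F]].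

Definition is_regular (P : set V) (S : set (set V)) :=
  exists (A : set V) (f : V -> R),
    [/\ finite_set A, A `<=` P, [set x | is_vertex P x] `<=` A
      & S = induced_subdivision A f].

Definition indicator (B : {set 'I_n}) : V := \row_i (i \in B)%:R.

Definition base_polytope (M : matroid 'I_n) : set V :=
  conv [set indicator B | B in [set` bases M]].

End Regular.

Arguments indicator R {n} B.
Arguments base_polytope R {n} M.

(* Main.v *)
Require Import Defs.
From mathcomp Require Import boolp classical_sets cardinality reals.
From mathcomp Require Import all_boot all_order all_algebra.
From mathcomp Require Import zify ring lra.

(** The height of a basis [B] is the sum of [w j i] over the pairs [i < j] in
    [B], for positive weights growing fast in the lexicographic order of
    [(j, i)]; this is a quadratic form evaluated at the indicator vector of
    [B]. The regular subdivision which it induces is the desired triangulation.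

    Its cells are the sets of bases minimizing the height plus a linear
    function [c]. All that is needed of a cell is that it is integrally free:
    a real combination of its indicator vectors which is integral, with
    integral total weight, has integral coefficients. This gives affine
    independence by scaling, and it says that the differences with one vertex
    form a lattice basis ([hull_simplex], [hull_unimodular]).

    Integral freeness of a cell is proved by induction on [k], for families of
    sets with the exchange property whose members agree from [k] on
    ([pair_height_cell]). In the step from [k] to [k + 1] the cell splits into
    the sets avoiding [k] and the sets containing [k]. Both parts are cells of
    the height truncated at [k], for the linear functions [c] and [c + w k]
    respectively. If the values of [c] on [X] are separated from the other
    values of [c] by a gap larger than the variation of the truncated height,
    then by basis exchange all sets of the first part meet [X] in the same
    number of elements ([gap_set_card]); likewise for [c + w k] and the second
    part. An integral combination [u + v], with [u] from the first part and [v]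
    from the second, therefore has integral sums of [u] over the gap sets of
    both [c] and [c + w k]. As [w k] grows fast, these sums determine [u]
    integrally, one coordinate at a time starting from the top
    ([gap_sets_integral]). So [u] and [v] are integral separately, and the
    induction hypothesis applies to each.

    That the lower faces of a lifted point configuration project to a
    subdivision is proved for any finite configuration
    ([lower_cells_subdivision]); the polytope is covered by Farkas' lemma. *)

Import Order.TTheory GRing.Theory Num.Theory.

(** * Exchange families *)

Section ExchangeFamilies.
Set Implicit Arguments.
Unset Strict Implicit.
Variable T : finType.
Implicit Types (F : {set {set T}}) (B X : {set T}).

(** The basis exchange property. The family may be empty, and its members need
    not span the ground set, so that it passes to the members which contain,
    or which avoid, a given element. *)
Definition exchange_family F := forall B1 B2 x,
  B1 \in F -> B2 \in F -> x \in B1 :\: B2 ->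
  exists2 y, y \in B2 :\: B1 & y |: (B1 :\ x) \in F.

Lemma card_swap B x y : x \in B -> y \notin B -> #|y |: (B :\ x)| = #|B|.
Proof.
move=> xB yB; rewrite cardsU1 !inE (negbTE yB) andbF /= (cardsD1 x B) xB.
by [].
Qed.

Lemma swap_setD B1 B2 x y : x \in B1 :\: B2 -> y \in B2 ->
  #|(y |: (B1 :\ x)) :\: B2| < #|B1 :\: B2|.
Proof.
move=> xD yB2; rewrite (cardsD1 x (B1 :\: B2)) xD ltnS subset_leq_card //.
apply/subsetP => z; rewrite !inE.
by case: (z =P y) => [->|_]; [rewrite yB2 | case: (z \in B2); case: (z == x)].
Qed.

Lemma exchange_card F B1 B2 : exchange_family F ->
  B1 \in F -> B2 \in F -> #|B1| = #|B2|.
Proof.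
move=> exF; have [m] := ubnP #|B1 :\: B2|; elim: m B1 => // m IHm B1 leBm B1F B2F.
have [D0|[x xD]] := set_0Vmem (B1 :\: B2).
  have [D0'|[y yD]] := set_0Vmem (B2 :\: B1).
    by congr #|pred_of_set _|; apply/eqP; rewrite eqEsubset -!setD_eq0 D0 D0' eqxx.
  by have [x] := exF _ _ _ B2F B1F yD; rewrite D0 inE.
have [y yD BF] := exF _ _ _ B1F B2F xD.
move: (xD) (yD); rewrite !inE => /andP[_ xB1] /andP[yB1 yB2].
rewrite -(card_swap xB1 yB1) (IHm _ _ BF B2F) //.
by rewrite -ltnS; apply: leq_trans leBm; rewrite ltnS swap_setD.
Qed.

(** Exchange in the dual form: the incoming element is prescribed. *)
Lemma dual_exchange F B1 B2 y : exchange_family F ->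
  B1 \in F -> B2 \in F -> y \in B2 :\: B1 ->
  exists2 x, x \in B1 :\: B2 & y |: (B1 :\ x) \in F.
Proof.
move=> exF B1F B2F; rewrite inE => /andP[yB1 yB2].
pose good B := [&& B \in F, y \in B & B1 :&: B2 \subset B].
have good2 : good B2 by rewrite /good B2F yB2 subsetIr.
(* A member between [B1 :&: B2] and as close to [B1] as possible among those
   containing [y] differs from [B1] in [y] only. *)
case: (arg_minnP (fun B => #|B :\: B1|) good2) => B /and3P[BF yB sB] minB.
have BD1 : B :\: B1 = [set y].
  apply/eqP; rewrite eqEsubset sub1set !inE yB1 yB !andbT.
  apply/subsetP => z zD; rewrite inE; apply: contraT => zy.
  have [u uD B'F] := exF _ _ _ BF B1F zD.
  move: (uD) (zD); rewrite !inE => /andP[uB uB1] /andP[zB1 zB].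
  have /minB : good (u |: (B :\ z)).
    rewrite /good B'F !inE (eq_sym y z) zy yB orbT /=.
    apply/subsetP => v vI; rewrite !inE (subsetP sB _ vI) andbT.
    by case: (v =P z) => [vz|]; rewrite ?orbT //; move: vI; rewrite inE vz (negbTE zB1).
  by rewrite leqNgt swap_setD.
have cDD : #|B1 :\: B| = 1.
  have := exchange_card exF B1F BF.
  have := cardsID B B1; have := cardsID B1 B; rewrite BD1 cards1 setIC; lia.
have /eqP/cards1P[x xE] := cDD.
have : x \in B1 :\: B by rewrite xE inE.
rewrite inE => /andP[xB xB1].
have xB2 : x \notin B2 by apply: contra xB => xB2; apply: (subsetP sB); rewrite inE xB1.
exists x; first by rewrite inE xB1 xB2.
suff -> : y |: (B1 :\ x) = B by [].
apply/setP => z; move/setP/(_ z): BD1; move/setP/(_ z): xE; rewrite !inE.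
case: (z =P y) => [->|_]; first by rewrite yB.
by case: (z \in B); case: (z \in B1); case: (z == x).
Qed.

Lemma card_swapI B X x y : x \in B -> y \notin B -> y \notin X -> x \notin X ->
  #|(y |: (B :\ x)) :&: X| = #|B :&: X|.
Proof.
move=> xB yB yX xX; congr #|pred_of_set _|; apply/setP => z; rewrite !inE.
by case: (z =P y) => [->|_]; rewrite ?(negbTE yX) ?andbF //=;
   case: (z =P x) => [->|_]; rewrite ?(negbTE xX) ?andbF.
Qed.

Lemma swapI_le B X x y : y \notin B -> y \in X ->
  #|B :&: X| <= #|(y |: (B :\ x)) :&: X|.
Proof.
move=> yB yX.
have -> : (y |: (B :\ x)) :&: X = y |: ((B :&: X) :\ x).
  apply/setP => z; rewrite !inE; case: (z =P y) => [->|_]; rewrite ?yX //=.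
  by rewrite andbA.
rewrite cardsU1 !inE (negbTE yB) andbF (cardsD1 x (B :&: X)) /=.
by rewrite leq_add2r leq_b1.
Qed.

(** A member of an exchange family that does not meet [X] in the largest
    possible number of elements can be improved by a single exchange. A better
    member [B'] is moved towards [B] until it differs from [B] in one element. *)
Lemma improving_exchange F X B B' : exchange_family F ->
  B \in F -> B' \in F -> #|B :&: X| < #|B' :&: X| ->
  exists i j, [/\ i \in X :\: B, j \in B :\: X & i |: (B :\ j) \in F].
Proof.
move=> exF BF; have [m] := ubnP #|B' :\: B|.
elim: m B' => // m IHm B' leBm B'F ltX.
have IH B2 : B2 \in F -> #|B2 :\: B| < #|B' :\: B| -> #|B' :&: X| <= #|B2 :&: X| ->
    exists i j, [/\ i \in X :\: B, j \in B :\: X & i |: (B :\ j) \in F].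
  move=> B2F ltB leX; apply: (IHm B2) => //; last exact: leq_trans leX.
  by apply: leq_trans ltB _.
(* When the next two cases are excluded, [B :\: B'] is disjoint from [X] and
   [B' :\: B] is contained in it. *)
have [D0|[j]] := set_0Vmem ((B :\: B') :&: X); last first.
  rewrite inE => /andP[jD jX].
  have [x xD B2F] := dual_exchange exF B'F BF jD.
  move: (jD); rewrite inE => /andP[jB' jB].
  by apply: (IH _ B2F); [apply: swap_setD | apply: swapI_le].
have notX y : y \in B :\: B' -> y \notin X.
  by move=> yD; apply/negP => yX; move/setP/(_ y): D0; rewrite !inE yX andbT -in_setD yD.
have [D1|[x]] := set_0Vmem ((B' :\: B) :\: X); last first.
  rewrite inE => /andP[xX xD].
  have [y yD B2F] := exF _ _ _ B'F BF xD.
  move: (yD) (xD); rewrite !inE => /andP[yB' yB] /andP[xB xB'].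
  by apply: (IH _ B2F); [apply: swap_setD | rewrite card_swapI // notX].
have sB'X : B' :\: B \subset X by rewrite -setD_eq0 D1.
have sBX : B :&: X \subset B'.
  apply/subsetP => z; rewrite inE => /andP[zB zX]; apply: contraT => zB'.
  by have := notX z; rewrite inE zB zB' zX => /(_ isT).
have cX : #|B' :&: X| = (#|B :&: X| + #|B' :\: B|)%N.
  rewrite -(cardsID B (B' :&: X)); congr (_ + _)%N; congr #|pred_of_set _|; apply/setP => z.
    rewrite !inE; have := subsetP sBX z; rewrite inE.
    by case: (z \in B); case: (z \in B'); case: (z \in X) => //= /(_ isT).
  rewrite !inE; have := subsetP sB'X z; rewrite inE.
  by case: (z \in B); case: (z \in B'); case: (z \in X) => //= /(_ isT).
have [x xD] : exists x, x \in B' :\: B by apply/set0Pn; rewrite -card_gt0; lia.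
have [y yD B2F] := exF _ _ _ B'F BF xD.
have xX := subsetP sB'X _ xD; have yX := notX _ yD.
move: (yD) (xD); rewrite !inE => /andP[yB' yB] /andP[xB xB'].
have [c1|c1] := leqP #|B' :\: B| 1.
  exists x, y; rewrite !inE xX xB yX yB; split=> //.
  have /eqP/cards1P[x' D1E] : #|B' :\: B| = 1%N by lia.
  have /eqP/cards1P[y' D2E] : #|B :\: B'| = 1%N.
    have := exchange_card exF BF B'F.
    have := cardsID B B'; have := cardsID B' B; rewrite setIC; lia.
  have x'E : x = x' by apply/eqP; move: xD; rewrite D1E inE.
  have y'E : y = y' by apply/eqP; move: yD; rewrite D2E inE.
  subst x' y'.
  suff -> : x |: (B :\ y) = B' by [].
  apply/setP => z; move/setP/(_ z): D1E; move/setP/(_ z): D2E; rewrite !inE.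
  by case: (z \in B); case: (z \in B'); case: (z == x); case: (z == y).
have c2 : (#|B' :&: X| <= #|(y |: (B' :\ x)) :&: X| + 1)%N.
  rewrite (cardsD1 x) inE xB' xX addnC leq_add2r subset_leq_card //.
  by apply/subsetP => z; rewrite !inE; case: (z == x); case: (z \in B'); rewrite ?orbT ?andbF.
apply: (IHm _ _ B2F); last by lia.
by apply: leq_trans (swap_setD xD yB) _.
Qed.

End ExchangeFamilies.

(** * Cells of the pair height *)

Section Heights.
Set Implicit Arguments.
Unset Strict Implicit.
Local Open Scope ring_scope.
Variables (R : realType) (n : nat).
Implicit Types (F A : {set {set 'I_n}}) (B X : {set 'I_n}) (c u : 'I_n -> R).

(** Half-open intervals of small total length do not cover a longer interval. *)
Lemma uncovered_point (s : seq (R * R)) (a L : R) :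
    {in s, forall p, 0 <= p.2} -> \sum_(p <- s) p.2 < L ->
  exists t, [/\ a <= t, t < a + L
              & {in s, forall p, ~~ (p.1 <= t < p.1 + p.2)}].
Proof.
have [m] := ubnP (size s); elim: m s a L => // m IHm s a L ltm s0 ltL.
have [/hasP[p ps /andP[pa ap]]|/hasPn nos] :=
  boolP (has (fun p => p.1 <= a < p.1 + p.2) s); last first.
  exists a; split=> //; rewrite ltrDl; apply: le_lt_trans ltL.
  by rewrite big_seq sumr_ge0.
(* The search continues from the right end of the interval containing [a]. *)
have /perm_to_rem pE := ps; have p0 := s0 p ps.
move: ltL; rewrite (perm_big _ pE) big_cons /= => ltL.
have sz : (size (rem p s) < m)%N by rewrite size_rem //; case: (s) ps ltm.
have s0' : {in rem p s, forall q, 0 <= q.2} by move=> q /mem_rem /s0.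
have [|t [at_ tL tno]] := IHm (rem p s) (p.1 + p.2) (L - p.2) sz s0'; first by lra.
exists t; split; [lra|lra|] => q; rewrite (perm_mem pE) inE => /predU1P[->|/tno//].
by rewrite [t < _]ltNge at_ andbF.
Qed.

(** [X] collects indices below [k] whose [c]-values are separated, by more
    than [delta], from the larger [c]-values of the other indices below [k]. *)
Definition gap_set (k : nat) (delta : R) c X :=
  {in X, forall i : 'I_n, (i < k)%N} /\
  forall i j, i \in X -> j \notin X -> (j < k)%N -> c i + delta < c j.

(** If [v] grows fast then gap sets of [c] and of [c + v] determine all
    coordinates integrally.  A threshold [t] between [c m] and [c m + v m] is
    chosen which separates [c i] from [c i + v i] for no [i < m]; the
    difference of the two gap sets below [t] then yields coordinate [m], up to
    the coordinates above [m]. *)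
Lemma gap_sets_integral k (delta : R) c (v u : 'I_n -> R) :
    0 <= delta -> (forall i, 0 <= v i) ->
    (forall m : 'I_n, (m < k)%N ->
       delta *+ n + delta *+ n + \sum_(i < n | (i < m)%N) v i < v m) ->
    (forall X, gap_set k delta c X -> \sum_(i in X) u i \is a Num.int) ->
    (forall X, gap_set k delta (fun i => c i + v i) X ->
       \sum_(i in X) u i \is a Num.int) ->
    (forall i : 'I_n, (k <= i)%N -> u i \is a Num.int) ->
  forall i, u i \is a Num.int.
Proof.
move=> d0 v0 vfast uX uY uk m.
have [p] := ubnP (n - m)%N; elim: p m => // p IHp m ltp.
have [/uk//|mk] := leqP k m.
have um (i : 'I_n) : (m < i)%N -> u i \is a Num.int.
  by move=> mi; apply: IHp; have := ltn_ord i; lia.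
pose s := [seq (c i, delta) | i : 'I_n <- index_enum 'I_n]
  ++ [seq (c i + v i, delta) | i : 'I_n <- index_enum 'I_n]
  ++ [seq (c i, v i) | i : 'I_n <- index_enum 'I_n & (i < m)%N].
have s0 : {in s, forall q, 0 <= q.2}.
  by move=> q; rewrite !mem_cat => /or3P[] /mapP[i _ ->] /=.
have ltv : \sum_(q <- s) q.2 < v m.
  rewrite !big_cat !big_map /= !sumr_const !card_ord addrA.
  by rewrite big_filter vfast.
have [t [tc tv tno]] := uncovered_point (c m) s0 ltv.
have c_no i : c i <= t -> c i + delta <= t.
  move=> ct; have /tno : (c i, delta) \in s by rewrite mem_cat map_f ?mem_index_enum.
  by rewrite /= ct -leNgt.
have cv_no i : c i + v i <= t -> c i + v i + delta <= t.
  move=> ct; have /tno : (c i + v i, delta) \in s.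
    by rewrite !mem_cat (map_f (fun i => (c i + v i, delta))) ?mem_index_enum ?orbT.
  by rewrite /= ct -leNgt.
have cm_no (i : 'I_n) : (i < m)%N -> (c i <= t) = (c i + v i <= t).
  move=> im; have /tno : (c i, v i) \in s.
    by rewrite !mem_cat (map_f (fun i => (c i, v i))) ?orbT // mem_filter im mem_index_enum.
  rewrite /= negb_and -ltNge -leNgt; have := v0 i.
  by case: (leP (c i) t) => h1; case: (leP (c i + v i) t) => h2 //= *; lra.
pose X := [set i : 'I_n | (i < k)%N && (c i <= t)].
pose Y := [set i : 'I_n | (i < k)%N && (c i + v i <= t)].
have /uX Xint : gap_set k delta c X.
  split=> [i|i j]; rewrite !inE => /andP[] // ik ct + jk.
  by rewrite jk /= -ltNge; apply: le_lt_trans; apply: c_no.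
have /uY Yint : gap_set k delta (fun i => c i + v i) Y.
  split=> [i|i j]; rewrite !inE => /andP[] // ik ct + jk.
  by rewrite jk /= -ltNge; apply: le_lt_trans; apply: cv_no.
have := rpredB Xint Yint; rewrite big_mkcond [X in _ - X]big_mkcond /= -sumrB.
rewrite (bigD1 m) //= !inE mk tc leNgt tv /= subr0 => mint.
rewrite -(rpredDr _ (x := \sum_(i < n | i != m)
  ((if i \in X then u i else 0) - (if i \in Y then u i else 0)))) //.
apply: rpred_sum => i im; rewrite !inE.
have [ltim|ltmi|eqim] := ltngtP i m; last by case/eqP: im; apply: val_inj.
  by rewrite -cm_no // subrr rpred0.
by apply: rpredB; case: ifP => _; rewrite ?rpred0 ?um.
Qed.

(** Affine unimodularity of the indicator vectors of [A]: a real combination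
    of them is integral, with integral total weight, only if its coefficients
    are.  Scaling a linear dependence shows that this includes affine
    independence. *)
Definition integrally_free A := forall l : {set 'I_n} -> R,
  (forall i, \sum_(B in A) l B * (i \in B)%:R \is a Num.int) ->
  \sum_(B in A) l B \is a Num.int -> forall B, B \in A -> l B \is a Num.int.

Lemma sum_card_const A X (l : {set 'I_n} -> R) :
    {in A &, forall B B', #|B :&: X| = #|B' :&: X|} ->
    \sum_(B in A) l B \is a Num.int ->
  \sum_(i in X) \sum_(B in A) l B * (i \in B)%:R \is a Num.int.
Proof.
move=> cX lint; have [->|[B0 B0A]] := set_0Vmem A.
  by apply: rpred_sum => i _; rewrite big_set0 rpred0.
rewrite exchange_big /=.
rewrite (eq_bigr (fun B => l B * (#|B0 :&: X|)%:R)) => [|B BA].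
  by rewrite -mulr_suml rpredM // rpred_nat.
rewrite -mulr_sumr (cX _ _ B0A BA); congr (_ * _).
rewrite -sum1_card natr_sum big_mkcond [RHS]big_mkcond /=; apply: eq_bigr => i _.
by rewrite inE; case: (i \in B); case: (i \in X).
Qed.

(** The value at [B] of the linear function with coefficients [c]. *)
Definition weight c B : R := \sum_(i in B) c i.

(** All members of a cell meet a gap set of [c] in the same number of elements,
    if the gaps exceed the variation of the height [h]: an exchange bringing in
    an element of the gap set would lower [h] plus the weight below its minimum. *)
Lemma gap_set_card F (h : {set 'I_n} -> R) (delta : R) c d k X :
    exchange_family F ->
    {in F &, forall B B' (i : 'I_n), (k <= i)%N -> (i \in B) = (i \in B')} ->
    (forall B, 0 <= h B <= delta) ->
    {in F, forall B, d <= h B + weight c B} -> gap_set k delta c X ->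
  {in [set B in F | h B + weight c B == d] &,
    forall B B', #|B :&: X| = #|B' :&: X|}.
Proof.
move=> exF agF hd ge_d [Xk Xgap].
suff le B B' : B \in F -> B' \in F -> h B + weight c B = d ->
    (#|B' :&: X| <= #|B :&: X|)%N.
  move=> B B'; rewrite !inE => /andP[BF /eqP hB] /andP[B'F /eqP hB'].
  by apply/eqP; rewrite eqn_leq !le.
move=> BF B'F hB; rewrite leqNgt; apply/negP => ltX.
have [i [j [iX jB B1F]]] := improving_exchange exF BF B'F ltX.
move: iX jB; rewrite !inE => /andP[iB iX] /andP[jX jB].
have jk : (j < k)%N.
  rewrite ltnNge; apply/negP => kj; have := agF _ _ BF B1F j kj.
  by rewrite !inE jB eqxx orbF; case: eqP => // ji; rewrite -ji jB in iB.
have := Xgap i j iX jX jk.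
have := ge_d _ B1F; rewrite -hB /weight big_setU1 ?inE ?(negbTE iB) ?andbF //=.
rewrite (big_setD1 j jB) /=.
have := hd B; have := hd (i |: (B :\ j)); lra.
Qed.

Variable w : 'I_n -> 'I_n -> R.

(** The height of [B], restricted to the pairs below [k]. *)
Definition pair_height (k : nat) B : R :=
  \sum_(j in B | (j < k)%N) \sum_(i in B | (i < j)%N) w j i.

(** An upper bound for the heights restricted to the pairs below [k]. *)
Definition total_height (k : nat) : R :=
  \sum_(j < n | (j < k)%N) \sum_(i < n | (i < j)%N) w j i.

Hypothesis w_ge0 : forall j i, 0 <= w j i.

Lemma pair_height_bound k B : 0 <= pair_height k B <= total_height k.
Proof.
rewrite /pair_height /total_height sumr_ge0 /=; last by move=> j _; apply: sumr_ge0.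
rewrite big_mkcondl ler_sum // => j _.
have s0 : 0 <= \sum_(i < n | (i < j)%N) w j i by apply: sumr_ge0.
case: ifP => // _; rewrite big_mkcondl ler_sum // => i _.
by case: ifP.
Qed.

Lemma pair_heightS (k : 'I_n) B : pair_height k.+1 B =
  pair_height k B + (if k \in B then \sum_(i in B | (i < k)%N) w k i else 0).
Proof.
rewrite /pair_height; case: ifP => kB.
  rewrite (bigD1 k) ?kB ?ltnSn //= addrC; congr (_ + _); apply: eq_bigl => j.
  by rewrite ltnS leq_eqVlt -val_eqE /=; case: (j \in B) => //=; case: ltngtP.
rewrite addr0; apply: eq_bigl => j; case: (boolP (j \in B)) => //= jB.
rewrite ltnS leq_eqVlt; case: eqP => // /val_inj jk.
by rewrite -jk jB in kB.
Qed.

Hypothesis w_fast : forall k m : 'I_n, (m < k)%N ->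
  total_height k *+ n + total_height k *+ n + \sum_(i < n | (i < m)%N) w k i < w k m.

(** The cells of the subdivision induced by [pair_height k], for families
    whose members agree from [k] on.  The members containing [k] and those
    avoiding it form two exchange families; [pair_height k.+1] exceeds
    [pair_height k] by the linear function [w k] on the former, and agrees with
    it on the latter. *)
Lemma pair_height_cell k F c d :
    (k <= n)%N -> exchange_family F ->
    {in F &, forall B B' (i : 'I_n), (k <= i)%N -> (i \in B) = (i \in B')} ->
    {in F, forall B, d <= pair_height k B + weight c B} ->
  integrally_free [set B in F | pair_height k B + weight c B == d].
Proof.
elim: k F c d => [|k IHk] F c d kn exF agF ge_d.
  move=> l _ + B BA.
  suff -> : [set B in F | pair_height 0 B + weight c B == d] = [set B] by rewrite big_set1.
  apply/setP => B'; rewrite in_set1; apply/idP/eqP => [|->//].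
  move: BA; rewrite !inE => /andP[BF _] /andP[B'F _].
  by apply/setP => i; apply: agF.
pose kk := Ordinal kn; pose v (i : 'I_n) := if (i < k)%N then w kk i else 0.
pose c1 i := c i + v i.
pose F0 := [set B in F | kk \notin B]; pose F1 := [set B in F | kk \in B].
have exF0 : exchange_family F0.
  move=> B1 B2 x; rewrite !inE => /andP[B1F k1] /andP[B2F k2] xD.
  have [y yD BF] : exists2 y, y \in B2 :\: B1 & y |: (B1 :\ x) \in F.
    by apply: exF => //; rewrite inE.
  exists y; rewrite // !inE BF (negbTE k1) andbF orbF /=.
  by apply: contra k2 => /eqP ->; move: yD; rewrite inE => /andP[].
have exF1 : exchange_family F1.
  move=> B1 B2 x; rewrite !inE => /andP[B1F k1] /andP[B2F k2] xD.
  have [y yD BF] : exists2 y, y \in B2 :\: B1 & y |: (B1 :\ x) \in F.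
    by apply: exF => //; rewrite inE.
  exists y; rewrite // !inE BF k1 andbT /=.
  by apply/orP; right; apply: contraNneq (proj1 (andP xD)) => <-.
have ag (Fb : {set {set 'I_n}}) b : (forall B, B \in Fb -> B \in F /\ (kk \in B) = b) ->
    {in Fb &, forall B B' (i : 'I_n), (k <= i)%N -> (i \in B) = (i \in B')}.
  move=> Fbk B B' /Fbk[BF Bk] /Fbk[B'F B'k] i; rewrite leq_eqVlt => /predU1P[ki|]; last exact: agF.
  by rewrite -(_ : kk = i) ?Bk ?B'k //; apply: val_inj.
have agF0 : {in F0 &, forall B B' (i : 'I_n), (k <= i)%N -> (i \in B) = (i \in B')}.
  by apply: (ag _ false) => B; rewrite inE => /andP[-> /negbTE].
have agF1 : {in F1 &, forall B B' (i : 'I_n), (k <= i)%N -> (i \in B) = (i \in B')}.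
  by apply: (ag _ true) => B; rewrite inE => /andP[].
have h0 B : B \in F0 -> pair_height k.+1 B + weight c B = pair_height k B + weight c B.
  by rewrite inE (pair_heightS kk) => /andP[_ /negbTE ->]; rewrite addr0.
have h1 B : B \in F1 -> pair_height k.+1 B + weight c B = pair_height k B + weight c1 B.
  rewrite inE (pair_heightS kk) => /andP[_ ->]; rewrite -addrA; congr (_ + _).
  rewrite addrC /weight big_split /=; congr (_ + _).
  by rewrite /v -big_mkcondr.
have ge0 : {in F0, forall B, d <= pair_height k B + weight c B}.
  by move=> B BF0; rewrite -h0 // ge_d //; move: BF0; rewrite inE => /andP[].
have ge1 : {in F1, forall B, d <= pair_height k B + weight c1 B}.
  by move=> B BF1; rewrite -h1 // ge_d //; move: BF1; rewrite inE => /andP[].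
pose A0 := [set B in F0 | pair_height k B + weight c B == d].
pose A1 := [set B in F1 | pair_height k B + weight c1 B == d].
have AE (f : {set 'I_n} -> R) :
    \sum_(B in [set B in F | pair_height k.+1 B + weight c B == d]) f B
  = \sum_(B in A0) f B + \sum_(B in A1) f B.
  rewrite (bigID (fun B : {set 'I_n} => kk \in B)) /= addrC; congr (_ + _); apply: eq_bigl => B.
    rewrite !inE andbAC; case: (boolP (B \in F)) => //= BF.
    by case: (boolP (kk \in B)) => //= kB; rewrite h0 // inE BF.
  rewrite !inE andbAC; case: (boolP (B \in F)) => //= BF.
  by case: (boolP (kk \in B)) => //= kB; rewrite h1 // inE BF.
move=> l lint; rewrite AE => Lint.
(* Coordinate [k] of the combination is the total weight of [A1]. *)
have L1 : \sum_(B in A1) l B \is a Num.int.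
  have := lint kk; rewrite AE big1 => [|B]; last first.
    by rewrite !inE -andbA => /and3P[_ /negbTE -> _]; rewrite mulr0.
  rewrite add0r (eq_bigr l) // => B.
  by rewrite !inE -andbA => /and3P[_ -> _]; rewrite mulr1.
have L0 : \sum_(B in A0) l B \is a Num.int by rewrite -(rpredDr _ L1).
have kn' : (k <= n)%N := ltnW kn.
have hb B := pair_height_bound k B.
pose u i := \sum_(B in A0) l B * (i \in B)%:R.
have uint : forall i, u i \is a Num.int.
  apply: (@gap_sets_integral k (total_height k) c v).
  - by case/andP: (hb finset.set0) => /le_trans; apply.
  - by move=> i; rewrite /v; case: ifP.
  - move=> m mk; rewrite {2}/v mk; apply: le_lt_trans (w_fast (k := kk) mk).
    by rewrite lerD2l ler_sum // => i im; rewrite /v (ltn_trans im mk).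
  - move=> X gX; apply: sum_card_const => //.
    exact: (gap_set_card exF0 agF0 hb ge0 gX).
  - move=> X gX.
    have Vint : \sum_(i in X) \sum_(B in A1) l B * (i \in B)%:R \is a Num.int.
      by apply: sum_card_const => //; exact: (gap_set_card exF1 agF1 hb ge1 gX).
    rewrite -(rpredDr _ Vint) -big_split /=; apply: rpred_sum => i _.
    by rewrite -AE.
  - move=> i ki; rewrite /u; have [A00|[B0 B0A]] := set_0Vmem A0.
      by rewrite A00 big_set0 rpred0.
    rewrite (eq_bigr (fun B => l B * (i \in B0)%:R)) => [|B BA].
      by rewrite -mulr_suml rpredM // rpred_nat.
    move: BA B0A; rewrite !(inE, in_setI) => BA B0A; congr (_ * _%:R); congr nat_of_bool.
    by apply: agF0 => //; rewrite inE; [case/andP: BA|case/andP: B0A].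
have vint i : \sum_(B in A1) l B * (i \in B)%:R \is a Num.int.
  by rewrite -(rpredDl _ (uint i)) -AE.
move=> B; rewrite inE => /andP[BF /eqP hB].
have [kB|kB] := boolP (kk \in B).
  apply: (IHk F1 c1 d kn' exF1 agF1 ge1 l vint L1).
  by rewrite !inE BF kB -h1 ?inE ?BF ?kB // hB /=.
apply: (IHk F0 c d kn' exF0 agF0 ge0 l uint L0).
by rewrite !inE BF kB -h0 ?inE ?BF ?kB // hB /=.
Qed.

End Heights.

(** * Fast growing weights *)

Section GeometricWeights.
Set Implicit Arguments.
Unset Strict Implicit.
Local Open Scope ring_scope.
Variables (R : realType) (n : nat).

Definition weight_base : R := (n.*2.+2)%:R.

(** Powers of a large base whose exponents order the pairs [i < j]
    lexicographically in [(j, i)]. *)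
Definition geometric_weight (j i : 'I_n) : R := weight_base ^+ (j * n + i).

Lemma weight_base_ge1 : 1 <= weight_base.
Proof. by rewrite ler1n. Qed.

Lemma geometric_weight_ge0 j i : 0 <= geometric_weight j i.
Proof. by rewrite exprn_ge0 // ler0n. Qed.

Lemma geometric_sum a m :
  \sum_(i < m) weight_base ^+ (a + i) * (weight_base - 1)
    = weight_base ^+ (a + m) - weight_base ^+ a.
Proof.
elim: m => [|m IHm]; first by rewrite big_ord0 addn0 subrr.
rewrite big_ord_recr /= IHm addnS exprS; ring.
Qed.

Lemma total_geometric_height (k : 'I_n) :
  total_height geometric_weight k * (weight_base - 1) <= weight_base ^+ (k * n) - 1.
Proof.
rewrite /total_height.
pose F (j : nat) : R := \sum_(i < n | (i < j)%N) weight_base ^+ (j * n + i).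
rewrite (eq_bigr (fun j : 'I_n => F j)) //.
rewrite -(big_ord_widen n F (ltnW (ltn_ord k))) mulr_suml.
have : (k <= n)%N by exact: ltnW.
elim: (k : nat) => [|j IHj] jn; first by rewrite big_ord0 subrr.
rewrite big_ord_recr /=; have := IHj (ltnW jn).
have : F j * (weight_base - 1) <= weight_base ^+ (j.+1 * n) - weight_base ^+ (j * n).
  rewrite /F -(big_ord_widen n (fun i => weight_base ^+ (j * n + i)) (ltnW jn)).
  rewrite mulr_suml geometric_sum lerB // ler_weXn2l ?weight_base_ge1 //.
  by rewrite mulSn addnC leq_add2r ltnW.
lra.
Qed.

Lemma geometric_weight_fast (k m : 'I_n) : (m < k)%N ->
  total_height geometric_weight k *+ n + total_height geometric_weight k *+ n
    + \sum_(i < n | (i < m)%N) geometric_weight k i < geometric_weight k m.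
Proof.
move=> mk; have := total_geometric_height k; set H := total_height _ _ => Hle.
rewrite -(big_ord_widen n (fun i => weight_base ^+ (k * n + i)) (ltnW (ltn_ord m))).
set G := \sum_(i < m) _.
have GE : G * (weight_base - 1) = weight_base ^+ (k * n + m) - weight_base ^+ (k * n).
  by rewrite /G mulr_suml geometric_sum.
have n0 : (1 <= n)%N by apply: leq_ltn_trans (ltn_ord k).
have le1 : weight_base ^+ (k * n) <= weight_base ^+ (k * n + m).
  by rewrite ler_weXn2l ?weight_base_ge1 // leq_addr.
have bE : weight_base - 1 = n%:R + n%:R + 1 by rewrite /weight_base -addnn -!natr1 natrD; ring.
have n1 : 1 <= n%:R :> R by rewrite ler1n.
have b1 : 0 < weight_base - 1 by rewrite bE; lra.
rewrite /geometric_weight -(ltr_pM2r b1) mulrDl GE -mulrnDr -mulr_natr mulrAC.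
set K := weight_base ^+ (k * n + m) in le1 *; set K0 := weight_base ^+ (k * n) in Hle le1 *.
apply: (@le_lt_trans _ _ ((K0 - 1) * (n + n)%:R + (K - K0))).
  by rewrite lerD2r ler_wpM2r.
rewrite natrD bE; set N := n%:R in n1 *.
have K0_ge0 : 0 <= K0 by rewrite exprn_ge0 // ler0n.
have : 0 <= (K - K0) * N by rewrite mulr_ge0 //; lra.
lra.
Qed.

End GeometricWeights.

(** * Convex hulls of finite configurations *)

Section ConvexHulls.
Set Implicit Arguments.
Unset Strict Implicit.
Local Open Scope classical_set_scope.
Local Open Scope ring_scope.
Variables (R : realType) (I : finType).

Lemma dot_sum m (D : {set I}) (l : I -> R) (g : I -> 'rV[R]_m) c :
  dot c (\sum_(i in D) l i *: g i) = \sum_(i in D) l i * dot c (g i).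
Proof.
rewrite /dot; under eq_bigr => j _ do rewrite summxE mulr_sumr.
rewrite exchange_big; apply: eq_bigr => i _ /=; rewrite mulr_sumr.
by apply: eq_bigr => j _; rewrite !mxE mulrCA.
Qed.

Lemma dotDl m (c c' x : 'rV[R]_m) : dot (c + c') x = dot c x + dot c' x.
Proof. by rewrite /dot -big_split; apply: eq_bigr => i _; rewrite mxE mulrDl. Qed.

Lemma dotZl m a (c x : 'rV[R]_m) : dot (a *: c) x = a * dot c x.
Proof. by rewrite /dot mulr_sumr; apply: eq_bigr => i _; rewrite mxE mulrA. Qed.

Lemma dot0l m (x : 'rV[R]_m) : dot 0 x = 0.
Proof. by rewrite -[0 in LHS](scale0r 0) dotZl mul0r. Qed.

Lemma dotBl m (c c' x : 'rV[R]_m) : dot (c - c') x = dot c x - dot c' x.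
Proof. by rewrite -scaleN1r dotDl dotZl mulN1r. Qed.

(** The point configuration [g i], for [i] in [D]. *)
Definition points m (g : I -> 'rV[R]_m) (D : {set I}) : set 'rV[R]_m :=
  [set g i | i in [set` D]].

Lemma hullP m (g : I -> 'rV[R]_m) (D : {set I}) x :
  conv (points g D) x <-> exists l : I -> R,
    [/\ forall i, 0 <= l i, \sum_(i in D) l i = 1 & x = \sum_(i in D) l i *: g i].
Proof.
split=> [[k [p [w [pD w0 w1 ->]]]]|[l [l0 l1 ->]]].
  have /boolp.choice[j jP] a : exists i, i \in D /\ g i = p a.
    by have [i iD <-] := pD a; exists i.
  exists (fun i => \sum_(a | j a == i) w a); split=> [i||].
  - exact: sumr_ge0.
  - by rewrite -w1 (partition_big j (mem D)) //= => a _; have [] := jP a.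
  - rewrite (partition_big j (mem D)) /= => [|a _]; last by have [] := jP a.
    apply: eq_bigr => i _; rewrite scaler_suml; apply: eq_bigr => a /eqP <-.
    by have [_ ->] := jP a.
exists #|D|, (fun a => g (enum_val a)), (fun a => l (enum_val a)); split=> //.
- by move=> a; exists (enum_val a) => //=; apply: enum_valP.
- by rewrite -[RHS]l1 [RHS]big_enum_val.
- by rewrite [LHS]big_enum_val.
Qed.

Lemma point_hull m (g : I -> 'rV[R]_m) (D : {set I}) i :
  i \in D -> conv (points g D) (g i).
Proof.
move=> iD; apply/hullP; exists (fun j => (j == i)%:R); split=> [j||].
- exact: ler0n.
- rewrite (bigD1 i) //= eqxx big1 ?addr0 // => j /andP[_ /negbTE ->] //.
- rewrite (bigD1 i) //= eqxx scale1r big1 ?addr0 // => j /andP[_ /negbTE ->].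
  by rewrite scale0r.
Qed.

(** Complementary slackness: a convex combination whose average slack [s]
    is not positive only involves the points of zero slack. *)
Lemma slack_hull m (g : I -> 'rV[R]_m) (D : {set I}) (l s : I -> R) :
    (forall i, 0 <= l i) -> \sum_(i in D) l i = 1 ->
    {in D, forall i, 0 <= s i} -> \sum_(i in D) l i * s i <= 0 ->
  conv (points g [set i in D | s i == 0]%SET) (\sum_(i in D) l i *: g i).
Proof.
move=> l0 l1 s0 ls; apply/hullP; exists l.
have ls0 i : i \in D -> s i != 0 -> l i = 0.
  move=> iD si; have /psumr_eq0P/(_ i iD)/eqP : \sum_(i in D) l i * s i = 0.
    by apply/le_anti; rewrite ls sumr_ge0 // => j jD; rewrite mulr_ge0 ?s0.
  by rewrite mulf_eq0 (negbTE si) orbF => H; apply/eqP/H => j jD; rewrite mulr_ge0 ?s0.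
have sub (M : nmodType) (G : I -> M) : (forall i, l i = 0 -> G i = 0) ->
    \sum_(i in D) G i = \sum_(i in [set i in D | s i == 0]%SET) G i.
  move=> G0; rewrite (bigID (fun i => s i == 0)) /= [X in _ + X]big1 ?addr0.
    by apply: eq_bigl => i; rewrite inE.
  by move=> i /andP[iD si]; rewrite G0 // ls0.
split=> //; first by rewrite -l1; apply/esym/sub.
by apply: sub => i ->; rewrite scale0r.
Qed.

Lemma hull_mono m (g : I -> 'rV[R]_m) (D E : {set I}) :
  E \subset D -> conv (points g E) `<=` conv (points g D).
Proof.
move=> /fintype.subsetP ED x [k [p [w [pE w0 w1 xE]]]].
by exists k, p, w; split=> // i; have [j jE <-] := pE i; exists j => //; apply: ED.
Qed.

Lemma hull_valid m (g : I -> 'rV[R]_m) (D : {set I}) c d :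
    {in D, forall i, d <= dot c (g i)} ->
  forall x, conv (points g D) x -> d <= dot c x.
Proof.
move=> cd x /hullP[l [l0 l1 ->]]; rewrite dot_sum -[d]mul1r -l1 mulr_suml.
by apply: ler_sum => i iD; rewrite ler_wpM2l ?cd.
Qed.

Lemma face_cut_hull m (g : I -> 'rV[R]_m) (D : {set I}) c d :
    {in D, forall i, d <= dot c (g i)} ->
  face_cut (conv (points g D)) c d
    = conv (points g [set i in D | dot c (g i) == d]%SET).
Proof.
move=> cd; apply/seteqP; split=> x.
  move=> [/hullP[l [l0 l1 ->]]]; rewrite dot_sum => ld.
  have -> : [set i in D | dot c (g i) == d]%SET = [set i in D | dot c (g i) - d == 0]%SET.
    by apply/finset.setP => i; rewrite !inE subr_eq0.
  apply: slack_hull => // [i iD|]; first by rewrite subr_ge0 cd.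
  under eq_bigr do rewrite mulrBr.
  by rewrite sumrB ld -mulr_suml l1 mul1r subrr.
move=> xE; split; first by apply: hull_mono xE; apply/fintype.subsetP => i; rewrite inE => /andP[].
case/hullP: xE => l [l0 l1 ->]; rewrite dot_sum.
rewrite (eq_bigr (fun i => l i * d)) => [|i]; first by rewrite -mulr_suml l1 mul1r.
by rewrite inE => /andP[_ /eqP ->].
Qed.

Lemma hull_face m (g : I -> 'rV[R]_m) (D : {set I}) F :
  is_face (conv (points g D)) F -> exists2 E : {set I}, E \subset D & F = conv (points g E).
Proof.
move=> [c [d [cd ->]]]; exists [set i in D | dot c (g i) == d]%SET.
  by apply/fintype.subsetP => i; rewrite inE => /andP[].
by apply: face_cut_hull => i iD; apply/cd/point_hull.
Qed.

Lemma points_seq m (g : I -> 'rV[R]_m) (D : {set I}) :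
  points g D = [set` map g (enum D)].
Proof.
apply/seteqP; split=> x /=.
  by move=> [i iD <-]; apply: map_f; rewrite mem_enum.
by move=> /mapP[i]; rewrite mem_enum => iD ->; exists i.
Qed.

End ConvexHulls.

(** * Farkas' lemma *)

Section Farkas.
Set Implicit Arguments.
Unset Strict Implicit.
Local Open Scope ring_scope.
Variables (R : realType) (W : lmodType R) (J : eqType).

(** Farkas' lemma for finitely many linear forms, by induction on their
    number.  If the last form [A j] cannot be dispensed with, then some [x0]
    satisfies the other constraints but not the conclusion, and all forms are
    projected along [x0] onto the kernel of [A j]. *)
Lemma farkas (s : seq J) (A : J -> W -> R) (phi : W -> R) : uniq s ->
    (forall j a x y, A j (a *: x + y) = a * A j x + A j y) ->
    (forall a x y, phi (a *: x + y) = a * phi x + phi y) ->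
    (forall y, {in s, forall j, A j y <= 0} -> phi y <= 0) ->
  exists2 l : J -> R, forall j, 0 <= l j
                    & forall y, phi y = \sum_(j <- s) l j * A j y.
Proof.
elim: s A phi => [|j s IHs] A phi.
  move=> _ _ lin le0; exists (fun=> 0) => // y; rewrite big_nil.
  have phiN : phi (- y) = - phi y.
    have phi0 : phi 0 = 0 by have := lin 1 0 0; rewrite scale1r addr0; lra.
    by have := lin (-1) y 0; rewrite addr0 scaleN1r phi0 addr0 mulN1r.
  by apply/le_anti; rewrite le0 // -oppr_le0 -phiN le0.
rewrite cons_uniq => /andP[js us] Alin lin le0.
have [noj|] := pselect (forall y, {in s, forall i, A i y <= 0} -> phi y <= 0).
  have [l l0 lE] := IHs A phi us Alin lin noj.
  exists (fun i => if i == j then 0 else l i) => [i|y]; first by case: ifP.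
  rewrite big_cons eqxx mul0r add0r lE [LHS]big_seq [RHS]big_seq; apply: eq_bigr => i is_.
  by case: eqP => // ij; rewrite -ij is_ in js.
move=> /existsNP[x0 /not_implyP[x0s /negP]]; rewrite -ltNge => phi0.
have Ax0 : 0 < A j x0.
  rewrite ltNge; apply/negP => Ax0; move: phi0; rewrite ltNge le0 // => i.
  by rewrite inE => /predU1P[->|/x0s].
have linB (psi : W -> R) : (forall a x y, psi (a *: x + y) = a * psi x + psi y) ->
    forall y, psi (- (A j y / A j x0) *: x0 + y) = psi y - psi x0 / A j x0 * A j y.
  by move=> plin y; rewrite plin; ring.
have [|||l l0 lE] := IHs (fun i y => A i y - A i x0 / A j x0 * A j y)
    (fun y => phi y - phi x0 / A j x0 * A j y) us.
- by move=> i a x y; rewrite !Alin; ring.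
- by move=> a x y; rewrite Alin lin; ring.
- move=> y ys; rewrite -linB //; apply: le0 => i.
  rewrite inE => /predU1P[->|is_]; rewrite linB //; last exact: ys.
  by rewrite divff ?gt_eqF // mul1r subrr.
exists (fun i => if i == j then (phi x0 - \sum_(i <- s) l i * A i x0) / A j x0 else l i).
  move=> i; case: ifP => // _; rewrite divr_ge0 ?(ltW Ax0) // subr_ge0.
  apply: le_trans (ltW phi0); rewrite big_seq; apply: sumr_le0 => k ks.
  by rewrite mulr_ge0_le0 ?x0s.
move=> y; rewrite big_cons eqxx.
have -> : \sum_(i <- s) (if i == j then (phi x0 - \sum_(i <- s) l i * A i x0) / A j x0
    else l i) * A i y = \sum_(i <- s) l i * A i y.
  rewrite [LHS]big_seq [RHS]big_seq; apply: eq_bigr => i is_.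
  by case: eqP => // ij; rewrite -ij is_ in js.
have := lE y; under eq_bigr => i _ do rewrite mulrBr.
have -> : \sum_(i <- s) (l i * A i y - l i * (A i x0 / A j x0 * A j y)) =
  \sum_(i <- s) l i * A i y - (\sum_(i <- s) l i * A i x0) / A j x0 * A j y.
  rewrite sumrB 2!mulr_suml; congr (_ - _); apply: eq_bigr => i _; ring.
by move=> /eqP; rewrite subr_eq => /eqP ->; ring.
Qed.

End Farkas.

(** * Regular subdivisions *)

Section RegularSubdivisions.
Set Implicit Arguments.
Unset Strict Implicit.
Local Open Scope classical_set_scope.
Local Open Scope ring_scope.
Variables (R : realType) (I : finType) (m : nat).
Local Notation V := 'rV[R]_m.
Variables (g : I -> V) (D : {set I}) (f : I -> R).
Implicit Types (c x : V) (d : R).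

(** Affine minorants [d - dot c x] of the heights [f] over the points [g]. *)
Definition minorant c d := {in D, forall i, d <= f i + dot c (g i)}.

(** The points at which a minorant touches the heights. *)
Definition contact c d : {set I} := [set i in D | f i + dot c (g i) == d]%SET.

(** The projections of the lower faces of the lifted configuration. *)
Definition lower_cells : set (set V) :=
  [set Q | exists c d, minorant c d /\ Q = conv (points g (contact c d))].

Lemma contact_sub c d : contact c d \subset D.
Proof. by apply/fintype.subsetP => i; rewrite inE => /andP[]. Qed.

Lemma hull_slack c d (l : I -> R) : \sum_(i in D) l i = 1 ->
  \sum_(i in D) l i * (f i + dot c (g i) - d)
    = \sum_(i in D) l i * f i + dot c (\sum_(i in D) l i *: g i) - d.
Proof.
move=> l1; under eq_bigr do rewrite mulrBr mulrDr.
by rewrite sumrB big_split /= -mulr_suml l1 mul1r dot_sum.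
Qed.

Lemma slack_contact c d (l : I -> R) :
    minorant c d -> (forall i, 0 <= l i) -> \sum_(i in D) l i = 1 ->
    \sum_(i in D) l i * f i + dot c (\sum_(i in D) l i *: g i) <= d ->
  conv (points g (contact c d)) (\sum_(i in D) l i *: g i).
Proof.
move=> min l0 l1 led.
have -> : contact c d = [set i in D | f i + dot c (g i) - d == 0]%SET.
  by apply/finset.setP => i; rewrite !inE subr_eq0.
apply: slack_hull => // [i iD|]; first by rewrite subr_ge0 min.
by rewrite hull_slack // subr_le0.
Qed.

(** Every point [x] of the polytope lies in a lower cell. With [h0] the infimum
    of the heights of the lifted polytope over [x], Farkas' lemma shows first
    that [h0] is attained, and then that some minorant takes at [x] a value not
    below [h0]. *)
Lemma lower_cells_cover x : conv (points g D) x ->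
  exists c d, minorant c d /\ conv (points g (contact c d)) x.
Proof.
move=> xD.
pose H : set R := [set h | exists l : I -> R, [/\ forall i, 0 <= l i,
  \sum_(i in D) l i = 1, x = \sum_(i in D) l i *: g i & h = \sum_(i in D) l i * f i]].
have H0 : H !=set0.
  by have /hullP[l [l0 l1 xE]] := xD; exists (\sum_(i in D) l i * f i), l.
have lbH : has_lbound H.
  exists (- \sum_(i in D) `|f i|) => _ [l [l0 l1 _ ->]]; rewrite -sumrN.
  apply: ler_sum => i iD; have : l i <= 1.
    by rewrite -l1 (bigD1 i) //= lerDl sumr_ge0.
  have := l0 i; have := ler_norm (- f i); rewrite normrN.
  have := normr_ge0 (f i); move: (l i) (f i) `|f i| => a b e; nra.
set h0 := inf H.
(* [W] is the space of triples [(c, d, s)], paired with lifted points [(y, h)]. *)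
pose W : lmodType R := (V * R^o * R^o)%type.
pose pair (y : V) (h : R) (w : W) : R := dot w.1.1 y + w.1.2 + w.2 * h.
have pair_lin y h a (w w' : W) : pair y h (a *: w + w') = a * pair y h w + pair y h w'.
  by rewrite /pair /= dotDl dotZl /GRing.scale /=; ring.
have pair_sum (l : I -> R) w : \sum_(i in D) l i * pair (g i) (f i) w =
    dot w.1.1 (\sum_(i in D) l i *: g i) + w.1.2 * \sum_(i in D) l i
     + w.2 * \sum_(i in D) l i * f i.
  rewrite dot_sum !mulr_sumr -!big_split /=; apply: eq_bigr => i _.
  by rewrite /pair; ring.
have pair_coord y z : (forall c, dot c y = dot c z) -> y = z.
  move=> yz; apply/rowP => j; have := yz (delta_mx 0 j).
  have dotd u : dot (delta_mx 0 j) u = u 0 j.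
    rewrite /dot (bigD1 j) //= mxE !eqxx mul1r big1 ?addr0 // => k /negbTE kj.
    by rewrite mxE kj mul0r.
  by rewrite !dotd.
pose J := option I; pose s : seq J := None :: map Some (enum D).
have us : uniq s.
  rewrite /= map_inj_uniq ?enum_uniq ?andbT; last by move=> ? ? [].
  by apply/mapP => -[].
have sS i : i \in D -> Some i \in s by move=> iD; rewrite inE map_f // mem_enum.
have sumS (F : J -> R) : \sum_(j <- s) F j = F None + \sum_(i in D) F (Some i).
  by rewrite big_cons big_map big_enum.
have attained : H h0.
  have [|||l l0 lE] := @farkas R W J s
      (fun j => if j is Some i then pair (g i) (f i) else fun w => w.2) (pair x h0) us.
  - by move=> [i|] a w w' //=; rewrite /= /GRing.scale.
  - exact: pair_lin.
  - move=> w wle; have w2 : w.2 <= 0 by apply: (wle None); rewrite inE.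
    have wD i : i \in D -> pair (g i) (f i) w <= 0 by move=> iD; apply: (wle (Some i)); apply: sS.
    have wH h : H h -> pair x h w <= 0.
      move=> [l [l0 l1 -> ->]]; rewrite {1}/pair.
      have := pair_sum l w; rewrite l1 mulr1 => <-.
      by apply: sumr_le0 => i iD; rewrite mulr_ge0_le0 ?wD.
    have [w20|w2n] := eqVneq w.2 0.
      by have [h /wH] := H0; rewrite /pair w20 !mul0r.
    have {}w2 : w.2 < 0 by rewrite lt_neqAle w2n.
    have : (dot w.1.1 x + w.1.2) / - w.2 <= h0.
      apply: lb_le_inf => // h /wH; rewrite /pair => le0.
      by rewrite ler_pdivrMr ?oppr_gt0 //; lra.
    by rewrite ler_pdivrMr ?oppr_gt0 // /pair; lra.
  have E w : pair x h0 w = l None * w.2 + (dot w.1.1 (\sum_(i in D) l (Some i) *: g i)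
       + w.1.2 * \sum_(i in D) l (Some i) + w.2 * \sum_(i in D) l (Some i) * f i).
    by rewrite lE sumS pair_sum.
  have l1 : \sum_(i in D) l (Some i) = 1.
    by have := E (0, 1, 0); rewrite /pair /= !dot0l; lra.
  have xE : x = \sum_(i in D) l (Some i) *: g i.
    by apply: pair_coord => c; have := E (c, 0, 0); rewrite /pair /=; lra.
  have Hl : H (\sum_(i in D) l (Some i) * f i) by exists (fun i => l (Some i)).
  suff -> : h0 = \sum_(i in D) l (Some i) * f i by [].
  apply/le_anti; rewrite ge_inf //=.
  have := l0 None; have := E (0, 0, 1); rewrite /pair /= !dot0l; lra.
have [w [wD wx w2]] : exists w : W, [/\ {in D, forall i, 0 <= pair (g i) (f i) w},
    pair x h0 w <= 0 & 0 < w.2].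
  apply: contrapT => now.
  have [|||l l0 lE] := @farkas R W J s
      (fun j => if j is Some i then fun w => - pair (g i) (f i) w else pair x h0)
      (fun w => w.2) us.
  - by move=> [i|] a w w' //=; rewrite pair_lin //; ring.
  - by move=> a w w'.
  - move=> w wle; rewrite leNgt; apply/negP => w2; apply: now; exists w; split=> //.
      by move=> i iD; rewrite -oppr_le0; apply: (wle (Some i)); apply: sS.
    by apply: (wle None); rewrite inE.
  have E w : w.2 = l None * pair x h0 w - (dot w.1.1 (\sum_(i in D) l (Some i) *: g i)
       + w.1.2 * \sum_(i in D) l (Some i) + w.2 * \sum_(i in D) l (Some i) * f i).
    rewrite [LHS]lE sumS -(pair_sum (fun i => l (Some i))); congr (_ + _); rewrite -sumrN.
    by apply: eq_bigr => i _; rewrite mulrN.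
  have l1 : \sum_(i in D) l (Some i) = l None.
    by have := E (0, 1, 0); rewrite /pair /= !dot0l; lra.
  have lf : l None * h0 - \sum_(i in D) l (Some i) * f i = 1.
    by have := E (0, 0, 1); rewrite /pair /= !dot0l; lra.
  have [lN|lN] := eqVneq (l None) 0.
    have lS i : i \in D -> l (Some i) = 0.
      by move=> iD; have /psumr_eq0P-> : \sum_(i in D) l (Some i) = 0 by rewrite l1.
    by move: lf; rewrite big1 => [|i iD]; rewrite ?lN ?lS // mul0r; lra.
  have lN0 : 0 < l None by rewrite lt_def lN l0.
  have : H ((\sum_(i in D) l (Some i) * f i) / l None).
    exists (fun i => l (Some i) / l None); split.
    - by move=> i; rewrite divr_ge0.
    - by rewrite -mulr_suml l1 divff.
    - apply: pair_coord => c; have := E (c, 0, 0); rewrite /pair /= !dot_sum => Ec.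
      apply: (mulfI lN); rewrite [RHS]mulr_sumr.
      under [RHS]eq_bigr => i _ do rewrite mulrA (mulrCA (l None)) divff // mulr1.
      by move: Ec; lra.
    - by rewrite mulr_suml; apply: eq_bigr => i _; rewrite mulrAC.
  by move/(ge_inf lbH); rewrite ler_pdivlMr // -/h0; lra.
exists (w.2^-1 *: w.1.1), (- w.1.2 / w.2).
have min : minorant (w.2^-1 *: w.1.1) (- w.1.2 / w.2).
  move=> i /wD; rewrite /pair dotZl ler_pdivrMr // mulrDl mulrAC mulVf ?gt_eqF //.
  lra.
split=> //; case: attained => l [l0 l1 xE hE].
rewrite xE; apply: slack_contact => //; rewrite -xE -hE dotZl.
move: wx; rewrite /pair ler_pdivlMr // mulrDl mulrAC mulVf ?gt_eqF //; lra.
Qed.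

(** Finitely many strict inequalities survive a small perturbation. *)
Lemma small_perturbation (P : pred I) (s t : I -> R) :
  (forall i, P i -> 0 < s i) -> exists2 e, 0 < e & forall i, P i -> e * t i < s i.
Proof.
move=> s0; pose S := \sum_(i | P i) `|t i| / s i.
have S0 : 0 <= S by apply: sumr_ge0 => i /s0 si; rewrite divr_ge0 // ltW.
exists (1 + S)^-1 => [|i Pi]; first by rewrite invr_gt0; lra.
have si := s0 i Pi; rewrite mulrC ltr_pdivrMr; last by lra.
apply: le_lt_trans (ler_norm _) _.
rewrite mulrC -ltr_pdivrMr // /S (bigD1 i) //=.
have : 0 <= \sum_(j | P j && (j != i)) `|t j| / s j.
  by apply: sumr_ge0 => j /andP[/s0 sj _]; rewrite divr_ge0 // ltW.
lra.
Qed.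

(** A face of a lower cell is cut out by a small tilt of the minorant. *)
Lemma lower_cells_face Q F : lower_cells Q -> is_face Q F -> lower_cells F.
Proof.
move=> [c [d [min ->]]] [c' [d' [val ->]]].
have val' : {in contact c d, forall i, d' <= dot c' (g i)}.
  by move=> i iE; apply/val/point_hull.
rewrite (face_cut_hull val').
have [|e e0 eP] := @small_perturbation (fun i => (i \in D) && (i \notin contact c d))
  (fun i => f i + dot c (g i) - d) (fun i => d' - dot c' (g i)).
  move=> i /andP[iD]; rewrite inE iD /= => iE.
  by rewrite subr_gt0 lt_def iE min.
have off i : i \in D -> i \notin contact c d ->
    d + e * d' < f i + dot (c + e *: c') (g i).
  by move=> iD iE; have := eP i; rewrite iD iE dotDl dotZl => /(_ isT); lra.
have on i : i \in contact c d ->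
    f i + dot (c + e *: c') (g i) - (d + e * d') = e * (dot c' (g i) - d').
  by rewrite inE dotDl dotZl => /andP[_ /eqP <-]; ring.
exists (c + e *: c'), (d + e * d'); split.
  move=> i iD; have [iE|/off/ltW] := boolP (i \in contact c d); last exact.
  by rewrite -subr_ge0 on // mulr_ge0 ?(ltW e0) // subr_ge0 val'.
congr (conv (points g _)); apply/finset.setP => i; rewrite !in_set.
have [iD|] //= := boolP (i \in D).
have [iE|iE] := boolP (i \in contact c d).
  have := iE; rewrite inE iD /= => ->.
  by rewrite -[RHS]subr_eq0 on // mulf_eq0 (gt_eqF e0) /= subr_eq0.
have := iE; rewrite inE iD /= => /negbTE ->.
by rewrite (gt_eqF (off _ iD iE)).
Qed.

(** Two cells meet in the face on which their minorants agree, since on each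
    cell its own minorant is the larger one. *)
Lemma lower_cells_meet Q Q' : lower_cells Q -> lower_cells Q' ->
  is_face Q (Q `&` Q').
Proof.
move=> [c [d [min ->]]] [c' [d' [min' ->]]].
have on c1 d1 x : conv (points g (contact c1 d1)) x -> exists l : I -> R,
   [/\ forall i, 0 <= l i, \sum_(i in D) l i = 1, x = \sum_(i in D) l i *: g i
     & d1 - dot c1 x = \sum_(i in D) l i * f i].
  move=> /hullP[l [l0 l1 xE]].
  have ext (M : nmodType) (G : I -> M) : \sum_(i in D) (if i \in contact c1 d1 then G i else 0)
      = \sum_(i in contact c1 d1) G i.
    rewrite -big_mkcondr; apply: eq_bigl => i; apply/andb_idl.
    exact: (fintype.subsetP (contact_sub c1 d1)).
  exists (fun i => if i \in contact c1 d1 then l i else 0); split.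
  - by move=> i; case: ifP.
  - by rewrite ext.
  - rewrite xE -ext; apply: eq_bigr => i _; case: ifP; rewrite ?scale0r //.
  - transitivity (\sum_(i in contact c1 d1) l i * f i); last first.
      by rewrite -ext; apply: eq_bigr => i _; case: ifP; rewrite ?mul0r.
    apply/eqP; rewrite subr_eq xE dot_sum -big_split -[eqbLHS]mul1r -[X in X * _]l1.
    rewrite mulr_suml; apply/eqP/eq_bigr => i.
    by rewrite inE => /andP[_ /eqP eqd]; rewrite /= -mulrDr eqd.
have le_slack c1 d1 (l : I -> R) : minorant c1 d1 -> (forall i, 0 <= l i) ->
    \sum_(i in D) l i = 1 ->
    d1 - dot c1 (\sum_(i in D) l i *: g i) <= \sum_(i in D) l i * f i.
  move=> min1 l0 l1; rewrite lerBlDr -subr_ge0 -hull_slack //.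
  by apply: sumr_ge0 => i iD; rewrite mulr_ge0 // subr_ge0 min1.
exists (c' - c), (d' - d); split.
  move=> x /on[l [l0 l1 xE lf]]; have := le_slack _ _ l min' l0 l1.
  rewrite -xE -lf dotBl; lra.
apply/seteqP; split=> x [xQ].
  move=> xQ'; split=> //; have [l [l0 l1 xE lf]] := on _ _ _ xQ.
  have [l' [l'0 l'1 xE' lf']] := on _ _ _ xQ'.
  have := le_slack _ _ l min' l0 l1; have := le_slack _ _ l' min l'0 l'1.
  by rewrite -xE -xE' -lf -lf' dotBl; lra.
have [l [l0 l1 xE lf]] := on _ _ _ xQ; rewrite dotBl => xeq; split=> //.
by rewrite xE; apply: slack_contact => //; rewrite -xE -lf; lra.
Qed.

Lemma lower_cells_subdivision : is_subdivision (conv (points g D)) lower_cells.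
Proof.
split.
- split; last first.
    by move=> _ [c [d [_ ->]]]; exists (map g (enum (contact c d))); rewrite -points_seq.
  apply: (@sub_finite_set _ _ ((fun E => conv (points g E)) @` [set: {set I}]%classic)).
    by move=> _ [c [d [_ ->]]]; exists (contact c d).
  exact/finite_image/finite_finset.
- apply/seteqP; split=> [x [_ [c [d [_ ->]]]]|x /lower_cells_cover[c [d [min xQ]]]].
    exact/hull_mono/contact_sub.
  by exists (conv (points g (contact c d))) => //; exists c, d.
- exact: lower_cells_face.
- move=> Q Q' SQ SQ'; split; first exact: lower_cells_meet.
  by rewrite classical_sets.setIC; apply: lower_cells_meet.
Qed.

End RegularSubdivisions.

(** * Subdivisions induced by a height function *)

Section InducedSubdivision.
Set Implicit Arguments.
Unset Strict Implicit.
Local Open Scope classical_set_scope.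
Local Open Scope ring_scope.
Variables (R : realType) (I : finType) (m : nat).
Variables (g : I -> 'rV[R]_m) (D : {set I}) (f : 'rV[R]_m -> R).

Lemma dot_lift (c : 'rV[R]_(m + 1)) x :
  dot c (lift_point f x) = dot (lsubmx c) x + c 0 (rshift m ord0) * f x.
Proof.
rewrite /dot big_split_ord /= big_ord1; congr (_ + _).
  by apply: eq_bigr => i _; rewrite row_mxEl mxE.
by rewrite row_mxEr mxE eqxx mulr1n.
Qed.

Lemma project_hull (E : {set I}) :
  [set lsubmx y | y in conv (points (lift_point f \o g) E)] = conv (points g E).
Proof.
have lsum (l : I -> R) : lsubmx (\sum_(i in E) l i *: (lift_point f \o g) i)
    = \sum_(i in E) l i *: g i.
  rewrite linear_sum; apply: eq_bigr => i _ /=.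
  by rewrite linearZ /= row_mxKl.
apply/seteqP; split=> [_ [y /hullP[l [l0 l1 ->]] <-]|x /hullP[l [l0 l1 ->]]].
  by apply/hullP; exists l; rewrite lsum.
exists (\sum_(i in E) l i *: (lift_point f \o g) i); last exact: lsum.
by apply/hullP; exists l.
Qed.

(** Scaling a functional with positive last coefficient makes that coefficient
    1, so the lower faces are those of the minorants. *)
Lemma induced_subdivisionE :
  induced_subdivision (points g D) f = lower_cells g D (f \o g).
Proof.
have lE : lift_point f @` points g D = points (lift_point f \o g) D.
  by rewrite /points image_comp.
have ptE i : i \in D -> conv (points (lift_point f \o g) D) (lift_point f (g i)).
  exact: (@point_hull _ _ _ (lift_point f \o g)).
rewrite /induced_subdivision lE; apply/seteqP; split=> Q.
  move=> [F [c [d [c0 val ->]]] ->]; set s := c 0 _ in c0.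
  rewrite face_cut_hull => [|i iD]; last exact/val/ptE.
  rewrite project_hull; exists (s^-1 *: lsubmx c), (d / s).
  have sE i : f (g i) + dot (s^-1 *: lsubmx c) (g i) = dot c (lift_point f (g i)) / s.
    by rewrite dot_lift -/s dotZl; field; rewrite gt_eqF.
  split=> [i iD|]; first by rewrite /= sE ler_pM2r ?invr_gt0 // val //; apply: ptE.
  congr (conv (points g _)); apply/finset.setP => i; rewrite !inE /= sE.
  by rewrite (inj_eq (mulIf _)) // invr_neq0 // gt_eqF.
move=> [c [d [min ->]]].
pose c' : 'rV[R]_(m + 1) := row_mx c 1%:M.
have cE i : dot c' (lift_point f (g i)) = f (g i) + dot c (g i).
  by rewrite dot_lift row_mxKl row_mxEr mxE eqxx mul1r addrC.
have val : {in D, forall i, d <= dot c' ((lift_point f \o g) i)}.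
  by move=> i iD; rewrite /= cE; apply: min.
exists (face_cut (conv (points (lift_point f \o g) D)) c' d).
  exists c', d; split=> //; first by rewrite row_mxEr mxE eqxx ltr01.
  exact: hull_valid.
rewrite face_cut_hull // project_hull; congr (conv (points g _)).
by apply/finset.setP => i; rewrite !inE /= cE.
Qed.

End InducedSubdivision.

(** * Simplices of indicator vectors *)

Section IndicatorSimplices.
Set Implicit Arguments.
Unset Strict Implicit.
Local Open Scope classical_set_scope.
Local Open Scope ring_scope.
Variables (R : realType) (n : nat).
Local Notation V := 'rV[R]_n.
Local Notation chi := (@indicator R n).
Implicit Types (E : {set {set 'I_n}}) (B : {set 'I_n}) (l : {set 'I_n} -> R).

Lemma sum_indicator E l i :
  (\sum_(B in E) l B *: chi B) 0 i = \sum_(B in E) l B * (i \in B)%:R.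
Proof. by rewrite summxE; apply: eq_bigr => B _; rewrite !mxE. Qed.

Lemma integral_indicator B : integral_point (chi B).
Proof. by move=> i; rewrite mxE rpred_nat. Qed.

Lemma integrally_free_int E l : integrally_free R E ->
    integral_point (\sum_(B in E) l B *: chi B) -> \sum_(B in E) l B = 0 ->
  {in E, forall B, l B \is a Num.int}.
Proof.
move=> freeE lint l0 B BE; apply: freeE BE; last by rewrite l0 rpred0.
by move=> i; rewrite -sum_indicator.
Qed.

Lemma integrally_free_zero E l : integrally_free R E ->
    \sum_(B in E) l B *: chi B = 0 -> \sum_(B in E) l B = 0 ->
  {in E, forall B, l B = 0}.
Proof.
move=> freeE lv l0 B BE; apply/eqP; apply: contraT => lB.
(* Rescaling the dependence makes its coefficient at [B] equal to 1/2. *)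
pose t := (l B *+ 2)^-1.
have l2 : l B *+ 2 != 0 by rewrite mulrn_eq0.
have /(_ B BE) : {in E, forall B, t * l B \is a Num.int}.
  apply: integrally_free_int => //; last by rewrite -mulr_sumr l0 mulr0.
  under eq_bigr do rewrite -scalerA.
  by rewrite -scaler_sumr lv scaler0 => i; rewrite mxE rpred0.
have tE : t * l B = 2^-1.
  by rewrite /t; field; rewrite lB.
rewrite tE => /intrP[z zE].
have : 1 = (2 * z)%:~R :> R by rewrite intrM -zE divff // pnatr_eq0.
move/eqP; rewrite -[1]/(1%:~R) eqr_int => /eqP; lia.
Qed.

Lemma sum_nth_map (J : eqType) (M : nmodType) (K : Type) (e : seq J) (h : J -> V)
    (G : K -> V -> M) (k : J -> K) (j0 : J) :
  \sum_(i < size (map h e)) G (k (nth j0 e i)) (map h e)`_i = \sum_(j <- e) G (k j) (h j).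
Proof.
rewrite (big_nth j0) -[in RHS](size_map h e) big_mkord; apply: eq_bigr => i _.
by rewrite (nth_map j0) // -(size_map h e).
Qed.

(** Coefficients indexed by the positions in a list without repetition, as a
    function of the entries; [k0] is the value at all other arguments. *)
Lemma coef_of_nth (J : eqType) (K : Type) (e : seq J) (h : J -> V) (k0 : K)
    (w : 'I_(size (map h e)) -> K) (j0 : J) : uniq e ->
  exists k : J -> K, forall i : 'I_(size (map h e)), w i = k (nth j0 e i).
Proof.
move=> ue; exists (fun j => if insub (index j e) is Some i then w i else k0) => i.
have ie : (i < size e)%N by rewrite -(size_map h e).
by rewrite index_uniq // valK.
Qed.

Lemma dot_indicator c B : dot c (chi B) = weight (fun i => c 0 i) B.
Proof.
rewrite /dot /weight [RHS]big_mkcond /=; apply: eq_bigr => i _.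
by rewrite mxE; case: (i \in B); rewrite ?mulr1 ?mulr0.
Qed.

(** Indicator vectors are in convex position: [chi B] is the only vertex of
    the cube which minimizes the functional [1 - 2 chi B]. *)
Lemma vertex_hullP E x : is_vertex (conv (points chi E)) x <->
  exists2 B, B \in E & x = chi B.
Proof.
split=> [/hull_face[E' E'E xE]|[B BE ->]].
  have [E'0|[B BE']] := set_0Vmem E'.
    have : conv (points chi E') x by rewrite -xE.
    by move=> /hullP[l [_ + _]]; rewrite E'0 big_set0 => /esym/eqP; rewrite oner_eq0.
  exists B; first exact: (fintype.subsetP E'E).
  by have := point_hull chi BE'; rewrite -xE => /esym.
pose c : V := \row_i (1 - 2 * (i \in B)%:R).
pose d : R := - \sum_(i < n) (i \in B)%:R.
have dE B' : dot c (chi B') - d = \sum_(i < n) ((i \in B) != (i \in B'))%:R.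
  rewrite /dot /d opprK -big_split /=; apply: eq_bigr => i _; rewrite !mxE.
  by case: (i \in B); case: (i \in B') => /=; ring.
have eqd B' : (dot c (chi B') == d) = (B' == B).
  rewrite -subr_eq0 dE; apply/idP/eqP => [|->]; last first.
    by rewrite big1 // => i _; rewrite eqxx.
  rewrite psumr_eq0 // => /allP BB'; apply/finset.setP => i.
  have := BB' i (mem_index_enum i); rewrite /= pnatr_eq0 eqb0 negbK.
  by move/eqP.
have val : {in E, forall B', d <= dot c (chi B')}.
  by move=> B' _; rewrite -subr_ge0 dE sumr_ge0.
exists c, d; split; first exact: hull_valid.
rewrite face_cut_hull //.
have -> : [set B' in E | dot c (chi B') == d]%SET = [set B]%SET.
  by apply/finset.setP => B'; rewrite !inE eqd; case: eqP => [->|]; rewrite ?BE ?andbF.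
apply/seteqP; split=> y.
  by move=> ->; apply: point_hull; rewrite inE.
by move=> /hullP[l [_ + ->]]; rewrite !big_set1 => ->; rewrite scale1r.
Qed.

Lemma aff_hullP E x : aff (conv (points chi E)) x <->
  exists l, \sum_(B in E) l B = 1 /\ x = \sum_(B in E) l B *: chi B.
Proof.
split=> [[k [p [w [pE w1 ->]]]]|[l [l1 ->]]].
  have /boolp.choice[q qP] a : exists l, \sum_(B in E) l B = 1 /\ p a = \sum_(B in E) l B *: chi B.
    by have /hullP[l [_ l1 ->]] := pE a; exists l.
  exists (fun B => \sum_a w a * q a B); split.
    rewrite exchange_big -[RHS]w1; apply: eq_bigr => a _ /=.
    by rewrite -mulr_sumr (qP a).1 mulr1.
  under [RHS]eq_bigr => B _ do rewrite scaler_suml.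
  rewrite exchange_big; apply: eq_bigr => a _ /=.
  by rewrite (qP a).2 scaler_sumr; apply: eq_bigr => B _; rewrite scalerA.
exists #|E|, (fun a => chi (enum_val a)), (fun a => l (enum_val a)); split.
- by move=> a; apply/point_hull/enum_valP.
- by rewrite -[RHS]l1 [RHS]big_enum_val.
- by rewrite [LHS]big_enum_val.
Qed.

Lemma lin_hullP E x : E != finset.set0 -> lin (conv (points chi E)) x <->
  exists l, \sum_(B in E) l B = 0 /\ x = \sum_(B in E) l B *: chi B.
Proof.
move=> /set0Pn[B0 B0E].
have B0aff : aff (conv (points chi E)) (chi B0).
  exists 1%N, (fun=> chi B0), (fun=> 1); rewrite !big_ord1 scale1r; split=> // _.
  exact: point_hull.
split=> [[->|[y [z [/aff_hullP[l [l1 ->]] /aff_hullP[l' [l'1 ->]] ->]]]]|[l [l0 ->]]].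
- by exists (fun=> 0); rewrite !big1 // => B _; rewrite scale0r.
- exists (fun B => l B - l' B); rewrite sumrB l1 l'1 subrr; split=> //.
  by rewrite -sumrB; apply: eq_bigr => B _; rewrite scalerBl.
right; exists (\sum_(B in E) l B *: chi B + chi B0), (chi B0).
split=> //; last by rewrite addrK.
have [l' [l'1 l'E]] := (aff_hullP E _).1 B0aff.
apply/aff_hullP; exists (fun B => l B + l' B); rewrite big_split /= l0 l'1 add0r; split=> //.
by rewrite l'E -big_split; apply: eq_bigr => B _; rewrite scalerDl.
Qed.

Lemma hull_simplex E : integrally_free R E -> is_simplex (conv (points chi E)).
Proof.
move=> freeE; exists (map chi (enum E)); last by rewrite -points_seq.
move=> w w0 wv i.
have [k wk] := coef_of_nth 0 w finset.set0 (enum_uniq (mem E)).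
rewrite wk; apply: (integrally_free_zero freeE).
- rewrite -big_enum -(sum_nth_map _ _ (fun (a : R) (v : V) => a *: v) k finset.set0) -[RHS]wv.
  by apply: eq_bigr => j _; rewrite wk.
- rewrite -big_enum -(sum_nth_map _ chi (fun (a : R) (v : V) => a) k finset.set0) -[RHS]w0.
  by apply: eq_bigr => j _; rewrite wk.
- by rewrite -mem_enum mem_nth // -(size_map chi).
Qed.

(** The edge vectors from a fixed vertex [B0] form a lattice basis: the
    coefficients of an integral vector are integers by integral freeness. *)
Lemma hull_unimodular E : integrally_free R E -> is_unimodular_simplex (conv (points chi E)).
Proof.
move=> freeE; split; first exact: hull_simplex.
  by move=> x /vertex_hullP[B _ ->]; apply: integral_indicator.
(* The empty simplex has no vertices, and its direction is 0. *)
have [E0|[B0 B0E]] := set_0Vmem E.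
  exists [::].
    split=> [//||x [y [z [/vertex_hullP[B]]]]]; first exact: nil_free.
    by rewrite E0 inE.
  split; first exact: nil_free.
  apply/seteqP; split=> x /=.
    move=> [[->|[y [z [/aff_hullP[l [+ _]]]]]] _].
      by exists (fun=> 0); rewrite big_ord0.
    by rewrite E0 big_set0 => /esym/eqP; rewrite oner_eq0.
  move=> [z ->]; rewrite big_ord0; split; first by left.
  by move=> i; rewrite mxE rpred0.
pose h B : V := chi B - chi B0; pose e := enum (E :\ B0).
have ue : uniq e := enum_uniq _.
have eE B : (B \in e) = (B != B0) && (B \in E) by rewrite mem_enum !inE.
(* Coefficients on [E :\ B0] extend to coefficients on [E] of total weight 0. *)
have ext (l : {set 'I_n} -> R) : exists l', [/\ \sum_(B in E) l' B = 0,
    \sum_(B <- e) l B *: h B = \sum_(B in E) l' B *: chi B & {in e, l' =1 l}].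
  exists (fun B => if B == B0 then - \sum_(B <- e) l B else l B); split.
  - rewrite (big_setD1 B0) //= eqxx; apply/eqP; rewrite addrC subr_eq0 big_enum /=; apply/eqP.
    by apply: eq_bigr => B; rewrite !inE => /andP[/negbTE ->].
  - rewrite (big_setD1 B0) //= eqxx; under eq_bigr do rewrite scalerBr.
    rewrite sumrB -scaler_suml scaleNr addrC; congr (_ - _); rewrite big_enum /=.
    by apply: eq_bigr => B; rewrite !inE => /andP[/negbTE ->].
  - by move=> B; rewrite eE => /andP[/negbTE ->].
have red (l : {set 'I_n} -> R) : \sum_(B in E) l B = 0 ->
    \sum_(B in E) l B *: chi B = \sum_(B <- e) l B *: h B.
  move=> l0; rewrite /h; under [RHS]eq_bigr do rewrite scalerBr.
  rewrite sumrB -scaler_suml [in RHS]big_enum /= [X in _ - X *: _]big_enum /=.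
  move: l0; rewrite (big_setD1 B0) //= => /eqP; rewrite addrC addr_eq0 => /eqP ->.
  by rewrite (big_setD1 B0) //= scaleNr opprK addrC.
have freeb : free (map h e).
  apply/(@freeP _ _ _ (in_tuple (map h e))) => w w0 i.
  have [k wk] := coef_of_nth 0 w finset.set0 ue.
  have [k' [k'0 kE k'k]] := ext k.
  have ie : nth finset.set0 e i \in e by rewrite mem_nth // -(size_map h).
  rewrite wk -k'k //; apply: (integrally_free_zero freeE) => //.
    rewrite -kE -(sum_nth_map _ _ (fun (a : R) (v : V) => a *: v) k finset.set0) -[RHS]w0.
    by apply: eq_bigr => j _; rewrite wk.
  by move: ie; rewrite eE => /andP[].
have hspan B : B \in E -> h B \in <<map h e>>%VS.
  move=> BE; have [->|BB0] := eqVneq B B0; first by rewrite /h subrr mem0v.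
  by rewrite memv_span // map_f // eE BB0.
exists (map h e).
  split=> // [x /mapP[B]|x [y [z [/vertex_hullP[B BE ->] /vertex_hullP[B' B'E ->] ->]]]].
    rewrite eE => /andP[_ BE] ->; exists (chi B), (chi B0).
    by split=> //; apply/vertex_hullP; [exists B|exists B0].
  rewrite free_cons negb_and negbK; apply/orP; left.
  by have -> : chi B - chi B' = h B - h B'; [rewrite /h opprB addrA subrK|rewrite rpredB ?hspan].
have E0 : E != finset.set0 by apply/set0Pn; exists B0.
split=> //; apply/seteqP; split=> x /=.
  move=> [/(lin_hullP _ E0)[l [l0 ->]]] xint.
  have lint := integrally_free_int freeE xint l0.
  exists (fun i => Num.floor (l (nth finset.set0 e i))).
  rewrite red // (sum_nth_map _ h (fun (a : int) (v : V) => v *~ a) (fun B => Num.floor (l B))).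
  rewrite big_seq [RHS]big_seq; apply: eq_bigr => B; rewrite eE => /andP[_ BE].
  by rewrite -scaler_int (floorK (lint B BE)).
move=> [z ->]; have [k zk] := coef_of_nth 0 z finset.set0 ue.
have -> : \sum_(i < size (map h e)) (map h e)`_i *~ z i = \sum_(B <- e) (k B)%:~R *: h B.
  rewrite -(sum_nth_map _ h (fun (a : int) (v : V) => a%:~R *: v) k finset.set0).
  by apply: eq_bigr => i _; rewrite zk scaler_int.
split.
  have [l [l0 -> _]] := ext (fun B => (k B)%:~R).
  by apply/(lin_hullP _ E0); exists l.
move=> i; rewrite summxE; apply: rpred_sum => B _.
by rewrite !mxE rpredM ?rpredB ?rpred_nat ?rpred_int.
Qed.

End IndicatorSimplices.

(** * The matroid base polytope *)

Section BasePolytope.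
Set Implicit Arguments.
Unset Strict Implicit.
Local Open Scope ring_scope.
Variables (R : realType) (n : nat) (M : matroid 'I_n).

(** The height function, a quadratic form without squares. *)
Definition quadratic_height (x : 'rV[R]_n) : R :=
  \sum_(j < n) \sum_(i < n | (i < j)%N) geometric_weight R j i * x 0 j * x 0 i.

Lemma quadratic_height_indicator B :
  quadratic_height (indicator R B) = pair_height (@geometric_weight R n) n B.
Proof.
rewrite /quadratic_height /pair_height [RHS]big_mkcond /=; apply: eq_bigr => j _.
rewrite ltn_ord andbT mxE; case: (j \in B); last first.
  by apply: big1 => i _; rewrite mulr0 mul0r.
rewrite [RHS]big_mkcondl /=; apply: eq_bigr => i _; rewrite mulr1 mxE.
by case: (i \in B); rewrite ?mulr1 ?mulr0.
Qed.

Lemma bases_contact_free c d :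
    minorant (@indicator R n) (bases M) (quadratic_height \o @indicator R n) c d ->
  integrally_free R
    (contact (@indicator R n) (bases M) (quadratic_height \o @indicator R n) c d).
Proof.
move=> min; have exM : exchange_family (bases M) := @bases_exchange _ M.
have hE B : (quadratic_height \o @indicator R n) B + dot c (indicator R B)
    = pair_height (@geometric_weight R n) n B + weight (fun i => c 0 i) B.
  by rewrite /= quadratic_height_indicator dot_indicator.
suff : integrally_free R [set B in bases M | pair_height (@geometric_weight R n) n B
    + weight (fun i => c 0 i) B == d].
  by congr integrally_free; apply/finset.setP => B; rewrite !inE hE.
apply: pair_height_cell => //.
- exact: geometric_weight_ge0.
- exact: geometric_weight_fast.
- by move=> B B' _ _ i; rewrite leqNgt ltn_ord.
- by move=> B BM; rewrite -hE; apply: min.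
Qed.

End BasePolytope.

Theorem theorem3p1 (R : realType) (n : nat) (M : matroid 'I_n) :
  exists S : set (set 'rV[R]_n),
    [/\ is_triangulation (base_polytope R M) S,
        is_unimodular S
      & is_regular (base_polytope R M) S].
Proof.
exists (induced_subdivision (points (@indicator R n) (bases M)) (@quadratic_height R n)).
have cell_free c d := @bases_contact_free R n M c d.
split.
- rewrite induced_subdivisionE; split; first exact: lower_cells_subdivision.
  by move=> _ [c [d [min ->]]]; apply/hull_simplex/cell_free.
- rewrite induced_subdivisionE => _ [c [d [min ->]]].
  exact/hull_unimodular/cell_free.
- exists (points (@indicator R n) (bases M)), (@quadratic_height R n); split=> //.
  + exact/finite_image/finite_finset.
  + by move=> _ [B BM <-]; apply: point_hull.
  + by move=> x /vertex_hullP[B BM ->]; exists B.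
Qed.
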